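(* Let $\rho_0:\mathbb{R}^d\setminus\{0\}\to[0,\infty)$ with $\rho_0\in L^1_{\mathrm{loc}}(\mathbb{R}^d\setminus\{0\})$, and assume that for some $z_0\in\mathbb{R}^d$ and some $\varepsilon>0$, $$\int_{\{|z-z_0|\le\varepsilon\}}\frac{dz}{\rho_0(z)}<\infty .$$ Then there exist a closed subset $F\subset\overline{B(z_0,\varepsilon)}=\{z\in\mathbb{R}^d:|z-z_0|\le\varepsilon\}$ and a constant $\delta>0$ such that $$\inf_{x\in\mathbb{R}^d,\ |x|\le\delta}\int_F\bigl(\rho_0(z)\wedge\rho_0(z-x)\bigr)\,dz>0 .$$
   Context: The convention $\frac10=+\infty$ is used. $a\wedge b=\min(a,b)$. $L^1_{\mathrm{loc}}(\mathbb{R}^d\setminus\{0\})$ is the space of measurable functions integrable (with respect to Lebesgue measure) over every compact subset of $\mathbb{R}^d\setminus\{0\}$. *)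

(* Defs.v *)
From HB Require Import structures.
From mathcomp Require Import all_boot all_order all_algebra.
From mathcomp Require Import all_classical all_reals all_analysis.

Set Implicit Arguments.
Unset Strict Implicit.
Unset Printing Implicit Defensive.
Import Order.TTheory GRing.Theory Num.Theory.
Import numFieldNormedType.Exports.

Local Open Scope classical_set_scope.
Local Open Scope ring_scope.

(* R^d with d >= 1 is 'rV[R]_n.+1, with the topology of the library.  The
   library norm of 'rV[R]_n.+1 is the sup norm (which gives the same topology);
   |z| below is the Euclidean norm. *)
Definition enorm (R : realType) (n : nat) (x : 'rV[R]_n) : R :=
  Num.sqrt (\sum_(i < n) x ord0 i ^+ 2).

Definition closed_eball (R : realType) (n : nat) (z : 'rV[R]_n) (r : R) :
  set 'rV[R]_n := [set y | enorm (y - z) <= r].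

Section lebesgue_outer_measure.
Context {R : realType} {n : nat}.
Implicit Types (a b : 'rV[R]_n.+1) (X : set 'rV[R]_n.+1).

Definition open_box (ab : 'rV[R]_n.+1 * 'rV[R]_n.+1) : set 'rV[R]_n.+1 :=
  [set x | forall i, ab.1 ord0 i < x ord0 i < ab.2 ord0 i].

Definition box_volume (ab : 'rV[R]_n.+1 * 'rV[R]_n.+1) : R :=
  \prod_(i < n.+1) (ab.2 ord0 i - ab.1 ord0 i).

(* The condition a_i <= b_i makes [box_volume] nonnegative; a = b gives the
   empty box, of volume 0. *)
Definition box_cover X : set (nat -> 'rV[R]_n.+1 * 'rV[R]_n.+1) :=
  [set B : nat -> 'rV[R]_n.+1 * 'rV[R]_n.+1 |
    (forall k i, (B k).1 ord0 i <= (B k).2 ord0 i) /\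
    X `<=` \bigcup_k open_box (B k)].

Definition lebesgue_outer X : \bar R :=
  ereal_inf [set (\sum_(k <oo) (box_volume (B k))%:E)%E | B in box_cover X].

Let box_volume_ge0 X B k : box_cover X B -> (0 <= (box_volume (B k))%:E)%E.
Proof.
by move=> [le_B _]; rewrite lee_fin prodr_ge0// => i _; rewrite subr_ge0.
Qed.

Lemma lebesgue_outer_ge0 X : (0 <= lebesgue_outer X)%E.
Proof.
apply: le_ereal_inf_tmp => _ [B BX <-].
by apply: nneseries_ge0 => k _ _; exact: box_volume_ge0 BX.
Qed.

Lemma lebesgue_outer0 : lebesgue_outer set0 = 0%E.
Proof.
apply/eqP; rewrite eq_le lebesgue_outer_ge0 andbT.
apply: ereal_inf_lbound; exists (fun=> (0, 0)) => /=; first by split.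
by apply: eseries0 => k _ _; rewrite /box_volume big_ord_recl/= subrr mul0r.
Qed.

Lemma le_lebesgue_outer : {homo lebesgue_outer : X Y / X `<=` Y >-> (X <= Y)%E}.
Proof.
move=> X Y XY; apply/ereal_inf_le_tmp => _ [B [le_B YB] <-].
by exists B => //; split => //; exact: subset_trans YB.
Qed.

Lemma lebesgue_outer_sigma_subadditive : sigma_subadditive lebesgue_outer.
Proof.
move=> A; have [[i ioo]|] := pselect (exists i, lebesgue_outer (A i) = +oo%E).
  rewrite (eseries_pinfty _ _ ioo) ?leey// => k _.
  by rewrite -ltNye (lt_le_trans _ (lebesgue_outer_ge0 _)).
rewrite -forallNE => Aoo.
suff add2e (e : {posnum R}) : (lebesgue_outer (\bigcup_k A k) <=
    \sum_(i <oo) lebesgue_outer (A i) + e%:num%:E)%E.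
  by apply/lee_addgt0Pr => _/posnumP[].
rewrite (le_trans _ (epsilon_trick _ _ _))//; last first.
  by move=> k; exact: lebesgue_outer_ge0.
pose P k B := box_cover (A k) B /\ (\sum_(j <oo) (box_volume (B j))%:E <=
  lebesgue_outer (A k) + (e%:num / (2 ^ k.+1)%:R)%:E)%E.
have [G PG] : {G & forall k, P k (G k)}.
  apply: (@choice _ _ P) => k; rewrite /P.
  have Afin : lebesgue_outer (A k) \is a fin_num.
    by rewrite ge0_fin_numE ?lebesgue_outer_ge0// ltey; apply/eqP/Aoo.
  have ek1 : 0 < e%:num / (2 ^ k.+1)%:R by [].
  have [_ [B BA <-] /ltW leB] := lb_ereal_inf_adherent ek1 Afin.
  by exists B.
pose v (ij : nat * nat) := (box_volume (G ij.1 ij.2))%:E.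
have v_ge0 ij : (0 <= v ij)%E by exact: box_volume_ge0 (PG ij.1).1.
apply: (@le_trans _ _ (\esum_(ij in setT) v ij)%E).
  have /card_esym/ppcard_eqP[f] := card_nat2.
  apply: ereal_inf_lbound; exists (fun k => G (f k).1 (f k).2).
    split=> [k i|]; first exact: (PG (f k).1).1.1.
    move=> t [i _ /((PG i).1.2)[j _ Gijt]].
    by exists (f^-1%FUN (i, j)) => //=; rewrite invK ?inE.
  rewrite -(esum_pred_image v _ xpredT) ?[fun=> _]set_true//.
  by rewrite image_eq.
rewrite (_ : esum _ _ = (\sum_(i <oo) \sum_(j <oo ) v (i, j))%E); last first.
  pose J : nat -> set (nat * nat) := fun i => [set (i, j) | j in setT].
  rewrite (_ : setT = \bigcup_k J k); last first.
    by rewrite predeqE => -[a b]; split => // _; exists a => //; exists b.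
  rewrite esum_bigcupT//=; last first.
    apply/trivIsetP => i j _ _ ij.
    rewrite predeqE => -[k m] /=; split => //= -[] [_] _ [<-{k} _].
    by move=> [m' _] [] /esym/eqP; rewrite (negbTE ij).
  rewrite -(image_id [set: nat]) -fun_true esum_pred_image//; last first.
    by move=> k _; exact: esum_ge0.
  apply: eq_eseriesr => /= j _.
  rewrite -(esum_pred_image v (pair j) predT)//=; last first.
    by move=> ? ? _ _; exact: (@can_inj _ _ _ snd).
  by congr esum; rewrite predeqE => -[a b]; split; move=> [i _ <-]; exists i.
apply: lee_nneseries => [i _ _|i _]; last exact: (PG i).2.
by apply: nneseries_ge0.
Qed.

HB.instance Definition _ := isOuterMeasure.Build R 'rV[R]_n.+1 lebesgue_outer
  lebesgue_outer0 lebesgue_outer_ge0 le_lebesgue_outer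
  lebesgue_outer_sigma_subadditive.

End lebesgue_outer_measure.

(* 'rV[R]_n.+1 is equipped with the sigma-algebra of Lebesgue (Caratheodory)
   measurable sets. *)
HB.instance Definition _ (R : realType) (n : nat) :=
  Measurable.copy 'rV[R]_n.+1 (caratheodory_type (@lebesgue_outer R n)).

Definition lebesgue_nd {R : realType} {n : nat} :
  set 'rV[R]_n.+1 -> \bar R := lebesgue_outer.

HB.instance Definition _ (R : realType) (n : nat) :=
  Measure.copy (@lebesgue_nd R n)
    ([the {outer_measure set 'rV[R]_n.+1 -> \bar R} of lebesgue_outer] :
      set (caratheodory_type (@lebesgue_outer R n)) -> \bar R).

(* Same as the library's [locally_integrable], which is for R only. *)
Definition locally_integrable_nd (R : realType) (n : nat)
    (D : set 'rV[R]_n.+1) (f : 'rV[R]_n.+1 -> R) : Prop :=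
  [/\ measurable_fun D f, open D &
      forall K, K `<=` D -> compact K ->
        (\int[lebesgue_nd]_(z in K) `|f z|%:E < +oo)%E].

(* Main.v *)
Require Import Defs.
From mathcomp Require Import all_boot all_order all_algebra.
From mathcomp Require Import all_classical all_reals all_analysis.
From mathcomp Require Import measurable_realfun.
From mathcomp Require Import ring lra.
Import Order.TTheory GRing.Theory Num.Theory.
Import numFieldNormedType.Exports.
Local Open Scope classical_set_scope.
Local Open Scope ring_scope.

(** Since [1 / rho0] is integrable on the Euclidean ball, [rho0] is positive
almost everywhere there.  Fix an open cube [Q] centred at [z0] inside the ball.
The sets [E k] of the points of the concentric cube of half side smaller by
[1 / k.+1] at which [rho0 >= 1 / k.+1] increase to almost all of [Q]
([measure_bigcup_inner_superlevel]), so one of them, [E], has measure more than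
half of that of [Q] ([exists_measure_gt]).  If [|x| <= 1 / k.+1], then [E] and
its translate [E + x] both lie in [Q], so inclusion-exclusion
([measure_add_le_inter]) gives
[mu (E `&` (E + x)) >= 2 mu E - mu Q > 0], a bound that does not depend on [x].
On [E `&` (E + x)] both [rho0 z] and [rho0 (z - x)] are at least [1 / k.+1];
hence [F], the whole closed ball, and [delta = 1 / k.+1] have the desired
property.

What this takes from Lebesgue measure on [R^d] is that boxes are measurable, that
cubes have finite positive measure, and that the measure is invariant under
translation.  With the measure given as an outer measure by coverings with open
boxes, the first reduces to half-spaces ([lebesgue_outer_split] together with
the nullity of hyperplanes), the last to translating coverings, and the second to
the fact that a box is not covered by boxes of smaller total volume
([le_sum_box_volume]), proved by integrating one coordinate at a time. *)

(** * Volume of boxes *)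

(** Integrating the hypothesis over one coordinate turns indicators of intervals
into their lengths; monotone convergence exchanges the integral with the series,
so the countable covering needs no compactness argument.  The weights [c] and
[w] are what makes the induction on the dimension work: once one coordinate is
frozen at [t], the indicators in this coordinate become weights. *)
Lemma le_sum_box_volume (R : realType) (n : nat) (a b : nat -> R)
    (A B : nat -> nat -> R) (c : R) (w : nat -> R) :
    0 <= c -> (forall k, 0 <= w k) ->
    (forall i, a i <= b i) -> (forall k i, A k i <= B k i) ->
    (forall x : nat -> R,
      ((c * \prod_(i < n) \1_`]a i, b i[ (x i))%:E <=
       \sum_(k <oo) (w k * \prod_(i < n) \1_`]A k i, B k i[ (x i))%:E)%E) ->
  ((c * \prod_(i < n) (b i - a i))%:E <=
   \sum_(k <oo) (w k * \prod_(i < n) (B k i - A k i))%:E)%E.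
Proof.
move=> + + ab AB; elim: n c w => [|n IH] c w c0 w0 cover.
  move: (cover (fun=> 0)); rewrite !big_ord0.
  under eq_eseriesr do rewrite big_ord0.
  by under [in X in _ -> X]eq_eseriesr do rewrite big_ord0.
have slice t : ((c * \prod_(i < n) (b i - a i) * \1_`]a n, b n[ t)%:E <=
    \sum_(k <oo)
      (w k * \prod_(i < n) (B k i - A k i) * \1_`]A k n, B k n[ t)%:E)%E.
  under eq_eseriesr do rewrite mulrAC.
  rewrite mulrAC; apply: IH => [|k|x].
  - by rewrite mulr_ge0.
  - by rewrite mulr_ge0.
  have := cover (fun i => if i == n then t else x i).
  rewrite big_ord_recr/= eqxx mulrA mulrAC.
  rewrite (eq_bigr (fun i : 'I_n => \1_`]a i, b i[ (x i) : R)); last first.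
    by move=> i _; rewrite ltn_eqF.
  congr (_ <= _)%E; apply: eq_eseriesr => k _; congr (_%:E).
  rewrite big_ord_recr/= eqxx mulrA mulrAC; congr (_ * _).
  by apply: eq_bigr => i _; rewrite ltn_eqF.
pose mu := @lebesgue_measure R.
have itvE (u v d : R) : u <= v -> 0 <= d ->
    (\int[mu]_t (d * \1_`]u, v[ t)%:E = (d * (v - u))%:E)%E.
  move=> uv d0; under eq_integral do rewrite EFinM.
  rewrite ge0_integralZl//; last first.
  - by apply/measurable_EFinP; exact: measurable_indic.
  rewrite integral_indic// setIT [X in (_ * X)%E]lebesgue_measure_itv/=.
  rewrite lte_fin EFinM.
  by case: ltP => // vu; rewrite (@le_anti _ _ u v) ?uv// subrr.
have prod_ge0 k : 0 <= \prod_(i < n) (B k i - A k i).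
  by apply: prodr_ge0 => i _; rewrite subr_ge0.
have mindic (u v d : R) :
    measurable_fun setT (fun t => (d * \1_`]u, v[ t)%:E : \bar R).
  by apply/measurable_EFinP; apply: measurable_funM => //.
rewrite big_ord_recr/= mulrA -itvE//; last first.
  by rewrite mulr_ge0// prodr_ge0// => i _; rewrite subr_ge0.
under eq_eseriesr.
  move=> k _; rewrite big_ord_recr/= mulrA -itvE//; last by rewrite mulr_ge0.
  over.
rewrite -integral_nneseries//; last 2 first.
- by move=> k; exact: mindic.
- by move=> k t _; rewrite lee_fin !mulr_ge0.
apply: ge0_le_integral => //.
- move=> t _; rewrite lee_fin !mulr_ge0// prodr_ge0// => i _.
  by rewrite subr_ge0.
- exact: mindic.
- apply: (ge0_emeasurable_sum (P := xpredT)) => [k t _ _|k _].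
    by rewrite lee_fin !mulr_ge0.
  exact: mindic.
Qed.

Section boxes.
Context {R : realType} {n : nat}.
Implicit Types (ab : 'rV[R]_n.+1 * 'rV[R]_n.+1) (X : set 'rV[R]_n.+1).

Lemma lebesgue_outer_le_box ab X : (forall i, ab.1 ord0 i <= ab.2 ord0 i) ->
  X `<=` open_box ab -> (lebesgue_outer X <= (box_volume ab)%:E)%E.
Proof.
move=> le_ab Xab; apply: ereal_inf_lbound.
(* empty boxes complete the covering *)
exists (fun k => if k == 0%N then ab else (0, 0)).
  by split=> [[|k] i//|x /Xab abx]; exists 0%N.
rewrite nneseries_recl//; last first.
  move=> [|k]; rewrite lee_fin prodr_ge0// => i _; first by rewrite subr_ge0.
  by rewrite subrr.
rewrite eseries_cond/= eseries0 ?adde0// => -[|k]//= _ _.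
by rewrite /box_volume big_ord_recl/= subrr mul0r.
Qed.

Lemma lebesgue_outer_box ab : (forall i, ab.1 ord0 i <= ab.2 ord0 i) ->
  lebesgue_outer (open_box ab) = (box_volume ab)%:E.
Proof.
move=> le_ab; apply/eqP; rewrite eq_le lebesgue_outer_le_box//=.
apply: le_ereal_inf_tmp => _ [B [le_B cover] <-].
pose lo (cd : 'rV[R]_n.+1 * 'rV[R]_n.+1) i : R := cd.1 ord0 (inord i).
pose up (cd : 'rV[R]_n.+1 * 'rV[R]_n.+1) i : R := cd.2 ord0 (inord i).
have volE cd : box_volume cd = 1 * \prod_(i < n.+1) (up cd i - lo cd i).
  by rewrite mul1r; apply: eq_bigr => i _; rewrite /up /lo inord_val.
rewrite volE; under eq_eseriesr do rewrite volE.
apply: (@le_sum_box_volume _ _ (lo ab) (up ab)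
  (fun k => lo (B k)) (fun k => up (B k)) 1 (fun=> 1)) => //.
- by move=> i; exact: le_ab.
- by move=> k i; exact: le_B.
move=> x.
pose y : 'rV[R]_n.+1 := \row_i x i.
have boxE cd : 1 * \prod_(i < n.+1) \1_`]lo cd i, up cd i[ (x i) =
    \1_(open_box cd) y :> R.
  rewrite mul1r [RHS]indicE; have [/set_mem ycd|/negP ycd] := boolP (y \in _).
    rewrite big1// => i _; rewrite indicE mem_set//= in_itv/= /lo /up inord_val.
    by have := ycd i; rewrite mxE.
  have [i yi] : exists i, ~ cd.1 ord0 i < y ord0 i < cd.2 ord0 i.
    by apply/existsNP => yi; apply: ycd; exact/mem_set.
  rewrite (bigD1 i)//= indicE memNset ?mul0r//= in_itv/= /lo /up inord_val.
  by move: yi; rewrite mxE.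
rewrite boxE; under eq_eseriesr do rewrite boxE.
have [yab|nyab] := pselect (open_box ab y); last first.
  by rewrite [X in (X%:E <= _)%E]indicE memNset// nneseries_ge0.
have [k _ yk] := cover _ yab.
rewrite [X in (X%:E <= _)%E]indicE mem_set//.
apply: (@le_trans _ _ (\sum_(0 <= j < k.+1) (\1_(open_box (B j)) y)%:E)%E).
  rewrite big_nat_recr//= [in leRHS]indicE mem_set//.
  by rewrite leeDr// sume_ge0.
by apply: nneseries_lim_ge.
Qed.

(** * Measurability of boxes *)

Definition set_coord (x : 'rV[R]_n.+1) (i : 'I_n.+1) (s : R) : 'rV[R]_n.+1 :=
  \row_j (if j == i then s else x ord0 j).

Lemma set_coord_id x i s : set_coord x i s ord0 i = s.
Proof. by rewrite mxE eqxx. Qed.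

Lemma set_coord_neq x i s j : j != i -> set_coord x i s ord0 j = x ord0 j.
Proof. by rewrite mxE => /negbTE ->. Qed.

(** The part of a hyperplane in a cube lies in arbitrarily thin boxes. *)
Lemma lebesgue_outer_hyperplane (i : 'I_n.+1) (t : R) :
  lebesgue_outer [set x : 'rV[R]_n.+1 | x ord0 i = t] = 0%E.
Proof.
pose S (m : nat) : set 'rV[R]_n.+1 :=
  [set x | x ord0 i = t /\ forall j, `|x ord0 j| < m%:R].
suff S0 m : lebesgue_outer (S m) = 0%E.
  apply/eqP; rewrite eq_le lebesgue_outer_ge0 andbT.
  apply: (@le_trans _ _ (lebesgue_outer (\bigcup_m S m))).
    apply: le_lebesgue_outer => x xi.
    exists (Num.bound (\sum_j `|x ord0 j|)) => //; split => // j.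
    apply: le_lt_trans (archi_boundP _); last by rewrite sumr_ge0.
    by rewrite (bigD1 j)//= lerDl sumr_ge0.
  apply: (le_trans (lebesgue_outer_sigma_subadditive _)).
  by rewrite eseries0.
apply/eqP; rewrite eq_le lebesgue_outer_ge0 andbT.
pose C : R := \prod_(j < n.+1 | j != i) (m%:R + m%:R).
have C0 : 0 <= C by rewrite prodr_ge0// => j _; rewrite addr_ge0.
apply/lee_addgt0Pr => e e0; rewrite add0e.
(* thickness for which the box has volume [2 h C <= e] *)
pose h := e / (2 * (C + 1)).
have h0 : 0 < h by rewrite divr_gt0// mulr_gt0// ltr_wpDl.
pose ab : 'rV[R]_n.+1 * 'rV[R]_n.+1 :=
  (set_coord (const_mx (- m%:R)) i (t - h),
   set_coord (const_mx m%:R) i (t + h)).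
apply: (@le_trans _ _ (box_volume ab)%:E).
  apply: lebesgue_outer_le_box => [j|x [xi xm] j].
    have [->|ji] := eqVneq j i.
      by rewrite !set_coord_id lerD2l ge0_cp// ltW.
    by rewrite !set_coord_neq// !mxE lerNl (@le_trans _ _ 0)// oppr_le0.
  have [->|ji] := eqVneq j i.
    by rewrite !set_coord_id xi ltrBlDr ltrDl h0.
  by rewrite !set_coord_neq// !mxE -ltr_norml.
rewrite lee_fin /box_volume (bigD1 i)//= !set_coord_id.
rewrite (eq_bigr (fun=> m%:R + m%:R)); last first.
  by move=> j ji; rewrite !set_coord_neq// !mxE opprK.
rewrite -/C (_ : t + h - (t - h) = h * 2); last by ring.
have <- : h * 2 * (C + 1) = e.
  by rewrite -mulrA divfK// gt_eqF// mulr_gt0// ltr_wpDl.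
by rewrite ler_wpM2l ?lerDl// mulr_ge0// ltW.
Qed.

Definition lower_box ab i s := (ab.1, set_coord ab.2 i s).
Definition upper_box ab i s := (set_coord ab.1 i s, ab.2).

Lemma box_volume_split ab i s :
  box_volume ab = box_volume (lower_box ab i s) + box_volume (upper_box ab i s).
Proof.
rewrite /box_volume [LHS](bigD1 i)//= [X in _ = X + _](bigD1 i)//=.
rewrite [X in _ = _ + X](bigD1 i)//= !set_coord_id.
under [in X in _ = X + _]eq_bigr => j ji do rewrite set_coord_neq//.
under [in X in _ = _ + X]eq_bigr => j ji do rewrite set_coord_neq//.
by rewrite -mulrDl; congr (_ * _); rewrite [RHS]addrC addrA subrK.
Qed.

(** Cutting each box of a covering of [X] along the hyperplane gives coverings of
the two parts of [X], with the same total volume. *)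
Lemma lebesgue_outer_split X (i : 'I_n.+1) (t : R) :
  (lebesgue_outer (X `&` [set x | (t < x ord0 i)%R]) +
   lebesgue_outer (X `&` [set x | (x ord0 i < t)%R]) <= lebesgue_outer X)%E.
Proof.
apply: le_ereal_inf_tmp => _ [B [le_B XB] <-].
(* [t] clamped to the side of the box, to keep the sides of the pieces ordered *)
pose s k := Num.max ((B k).1 ord0 i) (Num.min t ((B k).2 ord0 i)).
pose L k := lower_box (B k) i (s k).
pose U k := upper_box (B k) i (s k).
have le_L k j : (L k).1 ord0 j <= (L k).2 ord0 j.
  rewrite /=; have [->|ji] := eqVneq j i; last by rewrite set_coord_neq.
  by rewrite set_coord_id le_max lexx.
have le_U k j : (U k).1 ord0 j <= (U k).2 ord0 j.
  rewrite /=; have [->|ji] := eqVneq j i; last by rewrite set_coord_neq.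
  by rewrite set_coord_id ge_max le_B ge_min lexx orbT.
have vol_ge0 (D : nat -> 'rV[R]_n.+1 * 'rV[R]_n.+1) :
    (forall k j, (D k).1 ord0 j <= (D k).2 ord0 j) ->
    forall k, (0 <= (box_volume (D k))%:E)%E.
  by move=> le_D k; rewrite lee_fin prodr_ge0// => j _; rewrite subr_ge0.
under eq_eseriesr => k _ do rewrite (box_volume_split (B k) i (s k)) EFinD.
rewrite nneseriesD//; [|by move=> k _ _; exact: (vol_ge0 L)|
  by move=> k _ _; exact: (vol_ge0 U)].
rewrite addeC; apply: leeD; apply: ereal_inf_lbound.
- exists L => //; split => // x [/XB [k _ xk] /= xt].
  exists k => // j /=; have := xk j; have [->|ji] := eqVneq j i.
    by rewrite set_coord_id lt_max lt_min xt => /andP[-> ->]; rewrite orbT.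
  by rewrite set_coord_neq.
- exists U => //; split => // x [/XB [k _ xk] /= xt].
  exists k => // j /=; have := xk j; have [->|ji] := eqVneq j i.
    by rewrite set_coord_id gt_max gt_min xt => /andP[-> ->].
  by rewrite set_coord_neq.
Qed.

Lemma measurable_null_nd X : lebesgue_outer X = 0%E -> measurable X.
Proof.
move=> X0; apply: le_caratheodory_measurable => Y.
rewrite -[leRHS]add0e -X0; apply: leeD; apply: le_lebesgue_outer => x []//.
Qed.

Lemma measurable_halfspace_gt (i : 'I_n.+1) (t : R) :
  measurable [set x : 'rV[R]_n.+1 | t < x ord0 i].
Proof.
apply: le_caratheodory_measurable => X.
apply: le_trans (lebesgue_outer_split X i t); apply: leeD => //.
set Y := X `&` [set x | (x ord0 i < t)%R].
rewrite -[leRHS]adde0 -(lebesgue_outer_hyperplane i t).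
apply: le_trans (outer_measureU2 _ _ _); apply: le_lebesgue_outer => x [Xx /=].
by move=> /negP; rewrite -leNgt le_eqVlt => /predU1P[|]; [right|left].
Qed.

Lemma measurable_halfspace_lt (i : 'I_n.+1) (t : R) :
  measurable [set x : 'rV[R]_n.+1 | x ord0 i < t].
Proof.
rewrite (_ : mkset _ = ~` ([set x : 'rV[R]_n.+1 | t < x ord0 i] `|`
                          [set x | x ord0 i = t])).
  apply: measurableC; apply: measurableU; first exact: measurable_halfspace_gt.
  exact/measurable_null_nd/lebesgue_outer_hyperplane.
apply/seteqP; split => x /=.
  by move=> xt [|/eqP]; [rewrite ltNge (ltW xt)|rewrite lt_eqF].
by move=> /not_orP[/negP + /eqP]; rewrite -leNgt le_eqVlt => /orP[->|].
Qed.

Lemma measurable_open_box ab : measurable (open_box ab).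
Proof.
rewrite (_ : open_box ab = \bigcap_(k in setT)
  ([set x : 'rV[R]_n.+1 | ab.1 ord0 (inord k) < x ord0 (inord k)] `&`
   [set x : 'rV[R]_n.+1 | x ord0 (inord k) < ab.2 ord0 (inord k)])).
  apply: bigcapT_measurable => k; apply: measurableI.
    exact: measurable_halfspace_gt.
  exact: measurable_halfspace_lt.
apply/seteqP; split => x /=.
  by move=> xab k _; have /andP[] := xab (inord k).
by move=> xab i; have [] := xab i I; rewrite /= inord_val => -> ->.
Qed.

(** * Translations *)
Lemma le_lebesgue_outer_shift X (v : 'rV[R]_n.+1) :
  (lebesgue_outer [set z | X (z - v)%R] <= lebesgue_outer X)%E.
Proof.
apply: le_ereal_inf_tmp => _ [B [le_B XB] <-]; apply: ereal_inf_lbound.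
exists (fun k => ((B k).1 + v, (B k).2 + v)).
  split=> [k i|z /XB [k _ zk]]; first by rewrite /= !mxE lerD2r.
  by exists k => // i; have := zk i; rewrite /= !mxE ltrBrDr ltrBlDr.
apply: eq_eseriesr => k _; congr (_%:E); apply: eq_bigr => i _.
by rewrite /= !mxE opprD addrACA subrr addr0.
Qed.

Lemma lebesgue_outer_shift X (v : 'rV[R]_n.+1) :
  lebesgue_outer [set z | X (z - v)%R] = lebesgue_outer X.
Proof.
apply/eqP; rewrite eq_le le_lebesgue_outer_shift/=.
have := le_lebesgue_outer_shift [set z | X (z - v)%R] (- v).
apply: le_trans; apply: le_lebesgue_outer => z Xz /=.
by rewrite opprK addrK.
Qed.

Lemma measurable_shift X (v : 'rV[R]_n.+1) :
  measurable X -> measurable [set z | X (z - v)%R].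
Proof.
move=> mX; apply: le_caratheodory_measurable => Y.
(* translate the test set [Y] back, split it by [X], translate the parts *)
apply: le_trans (le_lebesgue_outer_shift Y (- v)).
rewrite [leRHS](mX [set z | Y (z - - v)%R]); apply: leeD.
  rewrite -[leRHS](lebesgue_outer_shift _ v).
  by apply: le_lebesgue_outer => z [Yz Xz]; split => //=; rewrite opprK subrK.
rewrite -[leRHS](lebesgue_outer_shift _ v).
by apply: le_lebesgue_outer => z [Yz Xz]; split => //=; rewrite opprK subrK.
Qed.

End boxes.

(** * Euclidean and sup norms, balls *)

Section balls.
Context {R : realType} {n : nat}.

Lemma norm_le_enorm (x : 'rV[R]_n.+1) : `|x| <= enorm x.
Proof.
rewrite [leLHS]mx_normrE; apply/bigmax_leP; split => [|[i j] _ /=].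
  exact: sqrtr_ge0.
rewrite ord1 -sqrtr_sqr ler_sqrt ?sumr_ge0// => [|k _]; last exact: sqr_ge0.
by rewrite (bigD1 j)//= lerDl sumr_ge0// => k _; exact: sqr_ge0.
Qed.

Lemma coord_le_norm (x : 'rV[R]_n.+1) i : `|x ord0 i| <= `|x|.
Proof.
by rewrite [leRHS]mx_normrE (le_trans _ (le_bigmax _ _ (ord0, i))).
Qed.

Lemma enorm_le_norm (x : 'rV[R]_n.+1) : enorm x <= n.+1%:R * `|x|.
Proof.
rewrite -[leRHS]ger0_norm ?mulr_ge0// -sqrtr_sqr ler_sqrt ?sqr_ge0//.
apply: (@le_trans _ _ (\sum_(i < n.+1) `|x| ^+ 2)).
  apply: ler_sum => i _; rewrite -[leLHS]real_normK ?num_real//.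
  by rewrite ler_pXn2r ?nnegrE// coord_le_norm.
rewrite sumr_const card_ord -[leLHS]mulr_natl exprMn ler_wpM2r ?sqr_ge0//.
by rewrite expr2 -natrM ler_nat leq_pmulr.
Qed.

Lemma continuous_enorm : continuous (@enorm R n.+1).
Proof.
have sum_sqr_cont : continuous (fun x : 'rV[R]_n.+1 => \sum_i x ord0 i ^+ 2).
  apply: continuous_big => [|i _ x]; first exact: add_continuous.
  apply: (@continuous_comp _ _ _ (fun x : 'rV[R]_n.+1 => x ord0 i)
    (fun t : R => t ^+ 2)).
    exact: coord_continuous.
  exact: exprn_continuous.
move=> x; apply: continuous_comp; first exact: sum_sqr_cont.
exact: sqrt_continuous.
Qed.

Lemma closed_closed_eball (z : 'rV[R]_n.+1) r : closed (closed_eball z r).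
Proof.
have shift_cont : continuous (fun y : 'rV[R]_n.+1 => y - z).
  move=> y; apply: (@cvgB _ _ _ (nbhs y) _ id (cst z)); first exact: cvg_id.
  exact: cvg_cst.
apply: (@preimage_closed _ _ (fun y => enorm (y - z)) [set t | t <= r]).
  move=> y _; apply: (@continuous_comp _ _ _ (fun y => y - z)).
    exact: shift_cont.
  exact: continuous_enorm.
exact: closed_le.
Qed.

(** The balls of the sup norm are cubes. *)
Lemma ball_open_box (z : 'rV[R]_n.+1) (r : R) : 0 < r ->
  ball z r = open_box (z - const_mx r, z + const_mx r).
Proof.
move=> r0; apply/seteqP; split => x.
  move=> [_ zx] i; have := zx ord0 i; rewrite /ball/= !mxE ltr_norml => ?; lra.
move=> zx; split=> // i j; rewrite (_ : i = ord0); last exact: ord1.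
by have := zx j; rewrite /ball/= !mxE ltr_norml; lra.
Qed.

Lemma measurable_ball_nd (z : 'rV[R]_n.+1) (r : R) : measurable (ball z r).
Proof.
have [r0|r0] := leP r 0.
  by rewrite (_ : ball z r = set0)// -subset0 => x [] /lt_geF; rewrite r0.
by rewrite ball_open_box//; exact: measurable_open_box.
Qed.

Lemma lebesgue_nd_ball (z : 'rV[R]_n.+1) (r : R) : 0 < r ->
  lebesgue_nd (ball z r) = ((r *+ 2) ^+ n.+1)%:E.
Proof.
move=> r0; rewrite ball_open_box// /lebesgue_nd lebesgue_outer_box => [|i].
  congr (_%:E); rewrite /box_volume (eq_bigr (fun=> r *+ 2)).
    by rewrite prodr_const card_ord.
  by move=> i _; rewrite !mxE; ring.
by rewrite !mxE; lra.
Qed.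

Lemma lebesgue_nd_set1 (z : 'rV[R]_n.+1) : lebesgue_nd [set z] = 0%E.
Proof.
apply/eqP; rewrite eq_le measure_ge0 andbT.
rewrite -[leRHS](@lebesgue_outer_hyperplane R n ord0 (z ord0 ord0)).
by apply: le_lebesgue_outer => x ->.
Qed.

End balls.

(** * Lower bounds for integrals and measures *)

(** The function equal to [c] on [A] and to [0] elsewhere is simple and is below
[f] on [D], so its integral is one of those whose supremum is the integral of
[f]. *)
Lemma le_integral_of_ge_on d (T : measurableType d) (R : realType)
    (mu : {measure set T -> \bar R}) (A D : set T) (f : T -> \bar R) (c : R) :
    measurable A -> A `<=` D -> (forall x, D x -> (0 <= f x)%E) ->
    0 <= c -> (forall x, A x -> (c%:E <= f x)%E) ->
  (c%:E * mu A <= \int[mu]_(x in D) f x)%E.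
Proof.
move=> mA AD f0 c0 cf; rewrite ge0_integralE//; apply: ereal_sup_ubound.
exists (scale_nnsfun (indic_nnsfun R mA) c0) => /=.
  move=> x; change ((c * \1_A x)%:E <= (f \_ D) x)%E; rewrite patchE indicE.
  have [xD|xD] := boolP (x \in D).
    have [xA|xA] := boolP (x \in A).
      by rewrite mulr1 cf//; exact: set_mem.
    by rewrite mulr0 f0//; exact: set_mem.
  rewrite (_ : x \in A = false) ?mulr0//; apply/negbTE/(contra _ xD).
  by move=> /set_mem/AD/mem_set.
by rewrite sintegralrM sintegral_indic.
Qed.

(** On [N] the integrand is infinite, so [c * mu N] is at most the integral
for every [c]. *)
Lemma measure_zeros_eq0 d (T : measurableType d) (R : realType)
    (mu : {measure set T -> \bar R}) (N D : set T) (f : T -> R) :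
    measurable N -> N `<=` D -> (forall x, D x -> 0 <= f x) ->
    (forall x, N x -> f x = 0) ->
    (\int[mu]_(x in D) ((f x)%:E)^-1 < +oo)%E ->
  mu N = 0%E.
Proof.
move=> mN ND f0 fN0 If.
have bound c : 0 <= c -> (c%:E * mu N <= \int[mu]_(x in D) ((f x)%:E)^-1)%E.
  move=> c0; apply: le_integral_of_ge_on => // x.
    by move=> Dx; rewrite inve_ge0 lee_fin f0.
  by move=> Nx; rewrite fN0// inve0 leey.
apply/eqP; rewrite eq_le measure_ge0 andbT; apply/lee_addgt0Pr => e e0.
rewrite add0e; set I := integral _ _ _ in If bound.
have I0 : (0 <= I)%E by have := bound 0 (lexx _); rewrite mul0e.
have Ifin : I \is a fin_num by rewrite ge0_fin_numE.
have J0 : 0 <= fine I by exact: fine_ge0.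
have c0 : 0 < (fine I + 1) / e by rewrite divr_gt0// ltr_wpDl.
rewrite -(@lee_pmul2l _ ((fine I + 1) / e)%:E) ?lte_fin//.
apply: (le_trans (bound _ (ltW c0))).
by rewrite -EFinM divfK ?gt_eqF// -(fineK Ifin) lee_fin lerDl.
Qed.

Lemma measure_add_le_inter d (T : measurableType d) (R : realType)
    (mu : {measure set T -> \bar R}) (A B Q : set T) :
    measurable A -> measurable B -> measurable Q -> A `<=` Q -> B `<=` Q ->
  (mu A + mu B <= mu (A `&` B) + mu Q)%E.
Proof.
move=> mA mB mQ AQ BQ; rewrite (measureDI mu mA mB) addeAC [leLHS]addeC.
apply: leeD => //.
rewrite -measureU//; last by rewrite setDE -setIA setICl setI0.
- apply: le_measure; rewrite ?inE//; last by move=> x [[/AQ]|/BQ].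
  by apply: measurableU => //; exact: measurableD.
- exact: measurableD.
Qed.

Lemma exists_measure_gt d (T : measurableType d) (R : realType)
    (mu : {measure set T -> \bar R}) (E : (set T)^nat) (m : \bar R) :
    (forall k, measurable (E k)) -> nondecreasing_seq E ->
    (m < mu (\bigcup_k E k))%E ->
  exists k, (m < mu (E k))%E.
Proof.
move=> mE ndE mlt; apply/not_existsP => le_m; move: mlt; apply/negP.
rewrite -leNgt.
have := nondecreasing_cvg_mu (mu := mu) mE (bigcupT_measurable _ mE) ndE.
by apply: cvge_le; apply: nearW => k /=; rewrite leNgt; exact/negP.
Qed.

(** * Superlevel sets and their translates *)

Section superlevel.
Context {R : realType} {n : nat}.
Implicit Types (rho : 'rV[R]_n.+1 -> R) (z : 'rV[R]_n.+1).

(** The margin [1 / k.+1] to the boundary of the cube leaves room for translations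
by vectors of length at most [1 / k.+1]. *)
Definition inner_superlevel rho z (r : R) (k : nat) : set 'rV[R]_n.+1 :=
  ball z (r - k.+1%:R^-1) `&` (~` [set 0] `&` rho @^-1` `[k.+1%:R^-1, +oo[).

Let measurable_setC0 : measurable (~` [set (0 : 'rV[R]_n.+1)]).
Proof.
by apply: measurableC; exact/measurable_null_nd/lebesgue_nd_set1.
Qed.

Lemma measurable_inner_superlevel rho z r k :
    measurable_fun (~` [set 0] : set 'rV[R]_n.+1) rho ->
  measurable (inner_superlevel rho z r k).
Proof.
move=> mrho.
apply: measurableI; first exact: measurable_ball_nd.
by apply: mrho => //; exact: measurable_itv.
Qed.

Lemma nondecreasing_inner_superlevel rho z r :
  nondecreasing_seq (inner_superlevel rho z r).
Proof.
move=> i j ij; have ji : j.+1%:R^-1 <= i.+1%:R^-1 :> R.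
  by rewrite lef_pV2 ?posrE// ler_nat.
apply/subsetPset => x [zx [x0 /=]]; rewrite in_itv/= andbT => ix; split.
  by apply: le_ball zx; rewrite lerB.
by split => //=; rewrite in_itv/= andbT (le_trans ji).
Qed.

(** What the union misses of the ball lies in [[set 0]] and the zeros of [rho]. *)
Lemma measure_bigcup_inner_superlevel rho z r (D : set 'rV[R]_n.+1) :
    measurable_fun (~` [set 0] : set 'rV[R]_n.+1) rho ->
    (forall x, x != 0 -> 0 <= rho x) -> ball z r `<=` D ->
    (\int[lebesgue_nd]_(x in D `\ 0%R) ((rho x)%:E)^-1 < +oo)%E ->
  (lebesgue_nd (ball z r) <=
   lebesgue_nd (\bigcup_k inner_superlevel rho z r k))%E.
Proof.
move=> mrho rho_ge0 ballD Irho.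
pose N := ball z r `&` (~` [set 0] `&` rho @^-1` [set 0]).
have mN : measurable N.
  by apply: measurableI; [exact: measurable_ball_nd|exact: mrho].
have N0 : lebesgue_nd N = 0%E.
  apply: (@measure_zeros_eq0 _ _ _ (@lebesgue_nd R n) N (D `\ 0%R) rho) => //.
  - by move=> x [/ballD Dx [x0 _]].
  - by move=> x [_ /eqP x0]; exact: rho_ge0.
  - by move=> x [_ []].
set U := \bigcup_k _.
apply: (@le_trans _ _ (lebesgue_nd U +
    (lebesgue_nd N + lebesgue_nd [set (0%R : 'rV[R]_n.+1)]))%E); last first.
  by rewrite N0 lebesgue_nd_set1 !adde0.
apply: le_trans (leeD2l _ (outer_measureU2 (@lebesgue_outer R n) _ _)).
apply: le_trans (outer_measureU2 (@lebesgue_outer R n) _ _).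
apply: le_lebesgue_outer => x zx.
have [->|x0] := eqVneq x 0; first by right; right.
have [rx0|rx0] := eqVneq (rho x) 0.
  by right; left; do 2!split => //; exact/eqP.
left; have rx : 0 < rho x by rewrite lt_neqAle eq_sym rx0 rho_ge0.
have zxr : 0 < r - `|z - x| by rewrite subr_gt0; move: zx; rewrite -ball_normE.
have m0 : 0 < Num.min (rho x) (r - `|z - x|) by rewrite lt_min rx.
pose k := Num.bound (Num.min (rho x) (r - `|z - x|))^-1.
have : k.+1%:R^-1 < Num.min (rho x) (r - `|z - x|).
  rewrite invf_plt ?posrE// (lt_trans (archi_boundP _)) ?invr_ge0 ?ltW//.
  by rewrite ltr_nat.
rewrite lt_min => /andP[krho kz]; exists k => //; split.
  by rewrite -ball_normE /ball_/= ltrBrDr addrC -ltrBrDr.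
by split; [exact/eqP|rewrite /= in_itv/= andbT ltW].
Qed.

End superlevel.

Theorem proposition1p5 (R : realType) (n : nat) (rho0 : 'rV[R]_n.+1 -> R)
    (rho0_ge0 : forall z, z != 0 -> 0 <= rho0 z)
    (rho0_loc : locally_integrable_nd (~` [set 0]) rho0)
    (z0 : 'rV[R]_n.+1) (eps : R) (eps_gt0 : 0 < eps)
    (rho0_inv : (\int[lebesgue_nd]_(z in closed_eball z0 eps `\ 0%R)
                   ((rho0 z)%:E)^-1 < +oo)%E) :
  exists (F : set 'rV[R]_n.+1) (delta : R),
    [/\ closed F, F `<=` closed_eball z0 eps, 0 < delta &
        (0 < ereal_inf
          [set \int[lebesgue_nd]_(z in F `\` [set 0%R; x])
                 (Num.min (rho0 z) (rho0 (z - x)%R))%:E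
           | x in [set x : 'rV[R]_n.+1 | (enorm x <= delta)%R]])%E].
Proof.
have [mrho _ _] := rho0_loc.
(* the cube of half side [r] is inside the ball as [enorm x <= n.+1 * `|x|] *)
pose r := eps / n.+1%:R.
have r0 : 0 < r by rewrite divr_gt0.
pose Q := ball z0 r.
have Qeps : Q `<=` closed_eball z0 eps.
  move=> x; rewrite /Q -ball_normE /ball_/= distrC => zx.
  rewrite /closed_eball/= (le_trans (enorm_le_norm _))//.
  by rewrite mulrC -ler_pdivlMr// ltW.
set q := (r *+ 2) ^+ n.+1.
have q0 : 0 < q by rewrite exprn_gt0// mulrn_wgt0.
have muQ : lebesgue_nd Q = q%:E by exact: lebesgue_nd_ball.
have [k Ek] : exists k,
    ((q / 2)%:E < lebesgue_nd (inner_superlevel rho0 z0 r k))%E.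
  apply: exists_measure_gt.
  - by move=> k; exact: measurable_inner_superlevel.
  - exact: nondecreasing_inner_superlevel.
  apply: (@lt_le_trans _ _ (lebesgue_nd Q)).
    by rewrite muQ lte_fin ltr_pdivrMr// ltr_pMr// ltr1n.
  exact: measure_bigcup_inner_superlevel mrho rho0_ge0 Qeps rho0_inv.
set E := inner_superlevel rho0 z0 r k in Ek.
have mE : measurable E by exact: measurable_inner_superlevel.
pose c : R := k.+1%:R^-1.
have c0 : 0 < c by rewrite invr_gt0.
have EQ : E `<=` Q by move=> x [zx _]; apply: le_ball zx; rewrite gerBl ltW.
have Efin : lebesgue_nd E \is a fin_num.
  rewrite ge0_fin_numE// (@le_lt_trans _ _ q%:E) ?ltry// -muQ.
  exact: le_lebesgue_outer.
set e := fine (lebesgue_nd E).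
have muE : lebesgue_nd E = e%:E by rewrite fineK.
have eq2 : 0 < e + e - q.
  by move: Ek; rewrite muE lte_fin; lra.
exists (closed_eball z0 eps), c; split => //.
  exact: closed_closed_eball.
apply: (@lt_le_trans _ _ (c * (e + e - q))%:E).
  by rewrite lte_fin mulr_gt0.
apply: le_ereal_inf_tmp => _ [x /= xc <-].
pose Ex := [set z | E (z - x)].
have mEx : measurable Ex by exact: measurable_shift.
have muEx : lebesgue_nd Ex = e%:E by rewrite -muE; exact: lebesgue_outer_shift.
have ExQ : Ex `<=` Q.
  move=> z [+ _]; rewrite /Q -!ball_normE /ball_/= => zx.
  rewrite (_ : z0 - z = (z0 - (z - x)) - x); last first.
    by rewrite opprB addrAC addrA subrK.
  rewrite (le_lt_trans (ler_normB _ _))// -(subrK c r) ltr_leD//.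
  exact: le_trans (norm_le_enorm _) xc.
apply: (@le_trans _ _ (c%:E * lebesgue_nd (E `&` Ex))%E).
  rewrite EFinM lee_pmul2l ?lte_fin// EFinB EFinD leeBlDr// -muQ -{1}muE -muEx.
  apply: measure_add_le_inter => //; exact: measurable_ball_nd.
apply: le_integral_of_ge_on => //.
- exact: measurableI.
- move=> z [Ez Exz]; split; first exact/Qeps/EQ.
  case=> zE.
    by have [_ [/(_ zE)]] := Ez.
  by have [_ [+ _]] := Exz; rewrite zE subrr; apply.
- move=> z [_ /not_orP[/eqP z0' /eqP zx]]; rewrite lee_fin le_min !rho0_ge0//.
  by rewrite subr_eq0.
- exact: ltW.
move=> z [[_ [_ Ez]] [_ [_ Exz]]].
move: Ez Exz; rewrite /= !in_itv/= !andbT => Ez Exz.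
by rewrite lee_fin le_min Ez.
Qed.
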